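(* For all positive integers $k\geq r\geq 2$, $$\begin{aligned} &\sum_{\substack{1\leq k_1,\dots,k_r\\k_1+\cdots+k_r=k}}\bigl(Z(2k_1,\dots,2k_r)+Z(2k_1-1,2k_2,\dots,2k_{r-1},2k_r+1)\bigr)\\ &=2^{2k+1}\,r\sum_{\substack{1\leq k_1,\dots,k_r\\k_1+\cdots+k_r=k}}t(2k_1,\dots,2k_r). \end{aligned}$$
   Context: For a complex number $a$ and a nonnegative integer $n$, let $(a)_0=1$ and $(a)_n=a(a+1)\cdots(a+n-1)$ for $n>0$. For $r\ge 1$ and positive integers $k_1,\dots,k_r$ with $k_r\geq 2$, define $$Z(k_1,\dots,k_r)=\sum_{0\leq n_1<\cdots<n_r}\frac{\left(\frac12\right)_{n_1}}{n_1!}\,\frac{1}{\left(n_1+\frac12\right)^{k_1}\cdots \left(n_r+\frac12\right)^{k_r}}\,\frac{n_r!}{\left(\frac12\right)_{n_r}},$$ $$t(k_1,\dots,k_r)=\sum_{0<n_1<\cdots<n_r}\frac 1{(2n_1-1)^{k_1}\cdots (2n_r-1)^{k_r}},$$ where the sums are over integers $n_1,\dots,n_r$. The sums in the claim are over $r$-tuples of positive integers $(k_1,\dots,k_r)$ with sum $k$; for $r=2$ the second summand on the left is $Z(2k_1-1,2k_2+1)$. *)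

(* Defs.v *)
From mathcomp Require Import all_boot all_order all_algebra.
From mathcomp Require Import all_classical all_reals all_analysis.
From mathcomp Require Import ring lra.

Set Implicit Arguments.
Unset Strict Implicit.
Unset Printing Implicit Defensive.
Import Order.TTheory GRing.Theory Num.Theory.
Local Open Scope classical_set_scope.
Local Open Scope ring_scope.

Definition pochhammer (R : pzSemiRingType) (a : R) (n : nat) : R :=
  \prod_(i < n) (a + i%:R).

(* The terms of both series are nonnegative, so each sum is taken in \bar R with
   [esum]. The index sets are the strictly increasing r-tuples of naturals;
   [head 0 n] and [last 0 n] are n_1 and n_r when r is positive. *)
Definition Z_sum (R : realType) (r : nat) (k : r.-tuple nat) : \bar R :=
  \esum_(n in [set n : r.-tuple nat | sorted ltn n])
    (pochhammer 2^-1 (head 0%N n) / ((head 0%N n)`!)%:R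
     * (\prod_(i < r) ((tnth n i)%:R + 2^-1) ^+ tnth k i)^-1
     * (((last 0%N n)`!)%:R / pochhammer 2^-1 (last 0%N n)))%:E.

Definition t_sum (R : realType) (r : nat) (k : r.-tuple nat) : \bar R :=
  \esum_(n in [set n : r.-tuple nat | all (ltn 0) n && sorted ltn n])
    ((\prod_(i < r) (2 * (tnth n i)%:R - 1) ^+ tnth k i)^-1)%:E.

(* The parts of a composition of k are at most k, so they are taken in 'I_k.+1. *)
Definition is_composition (r k : nat) (c : r.-tuple 'I_k.+1) : bool :=
  [forall i, (0 < tnth c i)%N] && (\sum_(i < r) tnth c i == k)%N.

(* (2c_1, ..., 2c_r) *)
Definition doubled (r k : nat) (c : r.-tuple 'I_k.+1) : r.-tuple nat :=
  [tuple (2 * tnth c i)%N | i < r].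

(* (2c_1 - 1, 2c_2, ..., 2c_(r-1), 2c_r + 1): the booleans are coerced to nat, and
   the truncated subtraction is exact because the parts are positive. *)
Definition doubled_shifted (r k : nat) (c : r.-tuple 'I_k.+1) : r.-tuple nat :=
  [tuple (2 * tnth c i - (i == 0 :> nat) + (i == r.-1 :> nat))%N | i < r].

(* Finiteness of these values makes an equality between sums of Z_sum values and
   sums of t_sum values one between convergent series. *)
Lemma t_sum_fin_num (R : realType) (r : nat) (k : r.-tuple nat) :
  (forall i, 2 <= tnth k i)%N -> t_sum R k \is a fin_num.
Proof.
move=> k2.
pose g (m : nat) : R := ((2 * m%:R - 1) ^+ 2)^-1.
have g0 m : 0 <= g m by rewrite invr_ge0 sqr_ge0.
have sumg N : \sum_(m < N.+1) g m <= 3 - 2 / (2 * N%:R + 1).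
  elim: N => [|N IH].
    by rewrite big_ord_recr big_ord0 /= /g mulr0 !add0r sqrrN expr1n invr1; lra.
  rewrite big_ord_recr /=; apply: (le_trans (lerD IH (lexx _))).
  rewrite /g -(natr1 N); set x : R := N%:R.
  have x0 : 0 <= x by exact: ler0n.
  rewrite -subr_ge0.
  have -> : 3 - 2 / (2 * (x + 1) + 1) -
      (3 - 2 / (2 * x + 1) + ((2 * (x + 1) - 1) ^+ 2)^-1) =
      (6 * x + 1) / ((2 * x + 1) ^+ 2 * (2 * x + 3)).
    by field; rewrite !gt_eqF //; lra.
  by apply: divr_ge0; [lra|apply: mulr_ge0; [exact: sqr_ge0|lra]].
have sumg3 N : \sum_(m < N.+1) g m <= 3.
  apply: le_trans (sumg N) _; rewrite gerBl divr_ge0 // addr_ge0 ?mulr_ge0 //.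
pose G (n : r.-tuple nat) : R := \prod_(i < r) g (tnth n i).
have G0 n : 0 <= G n by exact: prodr_ge0.
rewrite ge0_fin_numE; last first.
  apply: esum_ge0 => n /andP[/all_tnthP n0 _].
  rewrite lee_fin invr_ge0 prodr_ge0 // => i _; rewrite exprn_ge0 //.
  have : 1 <= (tnth n i)%:R :> R by rewrite ler1n; exact: n0.
  lra.
apply: (@le_lt_trans _ _ ((3 ^+ r : R)%:E)); last exact: ltry.
apply: ge_ereal_sup => _ [X [finX XD] <-].
apply: (@le_trans _ _ (\sum_(n \in X) (G n)%:E)%E).
  apply: lee_fsum => // n /XD /andP[/all_tnthP n0 _].
  rewrite lee_fin /G -prodfV ler_prod // => i _.
  have n1 : 1 <= (tnth n i)%:R :> R by rewrite ler1n; exact: n0.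
  have y1 : 1 <= 2 * (tnth n i)%:R - 1 :> R by lra.
  rewrite invr_ge0 exprn_ge0 ?(le_trans ler01) //= /g lef_pV2 ?posrE ?exprn_gt0 ?(lt_le_trans ltr01) //.
  exact: ler_weXn2l.
have [s Xs] : exists s : seq (r.-tuple nat), X = [set` s] by exact/finite_seqP.
pose M := (\max_(n <- s) \max_(i < r) tnth n i)%N.
pose h (u : r.-tuple 'I_M.+1) : r.-tuple nat := [tuple val (tnth u i) | i < r].
have hinj : injective h.
  move=> u v /(congr1 (fun w => tnth w)) e; apply: eq_from_tnth => i.
  by apply: val_inj; have := congr1 (fun w => w i) e; rewrite !tnth_mktuple.
apply: (@le_trans _ _ (\sum_(n \in h @` [set: _]) (G n)%:E)%E).
  apply: lee_fsum_nneg_subset => //.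
  - exact: finite_image.
  - move=> n; rewrite !inE => Xn.
    have le_n i : (tnth n i < M.+1)%N.
      rewrite ltnS; apply: leq_trans (leq_bigmax i) _.
      rewrite Xs /= in Xn.
      exact: (@leq_bigmax_seq _ s xpredT (fun n => \max_(i < r) tnth n i)%N).
    exists [tuple Ordinal (le_n i) | i < r] => //.
    by apply: eq_from_tnth => i; rewrite !tnth_mktuple.
  - by move=> n _; rewrite lee_fin.
rewrite fsbig_image; last by move=> u v _ _; exact: hinj.
have -> : (\sum_(u \in [set: r.-tuple 'I_M.+1]) (G (h u))%:E = \sum_u (G (h u))%:E)%E.
  rewrite [RHS]fsbig_seq ?index_enum_uniq //; apply: eq_fsbigl.
  by apply/seteqP; split => // u _ /=; rewrite mem_index_enum.
rewrite sumEFin lee_fin.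
rewrite (_ : \sum_u _ = \sum_(f : {ffun 'I_r -> 'I_M.+1}) \prod_(i < r) g (f i)).
  rewrite -(bigA_distr_bigA (fun (_ : 'I_r) (j : 'I_M.+1) => g j)) /= -[r in leRHS]card_ord -prodr_const.
  by apply: ler_prod => i _; rewrite sumr_ge0 //= sumg3.
rewrite (reindex (fun f : {ffun 'I_r -> 'I_M.+1} => [tuple f i | i < r])) /=.
  by apply: eq_bigr => f _; apply: eq_bigr => i _; rewrite !tnth_mktuple.
exists (fun u => [ffun i => tnth u i]) => [f _|u _].
  by apply/ffunP => i; rewrite ffunE tnth_mktuple.
by apply: eq_from_tnth => i; rewrite tnth_mktuple ffunE.
Qed.

(* Main.v *)
Require Import Defs.
From mathcomp Require Import all_boot all_order all_algebra.
From mathcomp Require Import all_classical all_reals all_analysis.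
From mathcomp Require Import qpoly polydiv.
From mathcomp Require Import ring lra zify.

(** Write x_n = n + 1/2 and a_n = (1/2)_n / n!.  For a tuple n_1 < ... < n_r let
    C(n_1,...,n_r) be the sum, over the compositions (c_1,...,c_r) of k, of the
    product of the x_{n_i}^(-2 c_i).  After exchanging the finite sum over
    compositions with the series, the left-hand side is the sum over
    0 <= n_1 < ... < n_r of W(n_1, n_r) C(n_1,...,n_r), where
    W(m, n) = (a_m / a_n) (1 + x_m / x_n), while the right-hand side is the sum of
    2 r C(n_1,...,n_r) over the same tuples, because 2 n - 1 = 2 x_{n-1}.  The
    two sums do not agree term by term.

    The idea is that the equality is the limit of an exact identity between
    finite sums.  Restrict to n_r < P and multiply W(m, n) by the product over
    1 <= i <= m of (P + i - 1/2) / (P + i) and by the product over 1 <= i <= n of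
    (P - i) / (P - i - 1/2).  The resulting kernel K_P satisfies

      sum of K_P(n_1, n_r) y_{n_1} ... y_{n_r}
        = sum of (K_P(n_1, n_1) + ... + K_P(n_r, n_r)) y_{n_1} ... y_{n_r}

    for y_n = 1 / (x_n^2 - Z) in any commutative algebra over the base field
    ([cut_identity]); both sums range over n_1 < ... < n_r < P.  As P grows with m
    and n fixed, K_P(m, n) tends to W(m, n), and in particular the diagonal
    K_P(n, n) tends to 2, which turns the right-hand weight into 2 r.  Since C is
    the coefficient of Z^(k-r) in y_{n_1} ... y_{n_r} ([coef_prod_inv_series]),
    the identity is applied in the ring of polynomials modulo Z^k.

    The finite identity goes by induction on P.  Let T_r^P be either side and
    lambda = (P^2 - 1/4) / (P (P + 1)); both sides satisfy

      lambda (x_P^2 - Z) T_r^{P+1} = T_{r-1}^P + (P^2 - Z) T_r^P,  with T_0^P = 0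

    ([headlast_sum_step] for r > 1, [marked_sum_step]).  Summed over r against w^(r-1), this
    says that both are a constant multiple of the product of the q^2 - (Z - w)
    for 0 < q < P, divided by the product of the x_j^2 - Z for j < P: the
    right-hand side is the Lagrange interpolation of the numerator, as a
    polynomial in Z - w, at the points x_j^2.  For the left-hand side the
    coefficient of the product of the y in the recursion is rewritten as
    alpha (x_{n_1}^2 - Z) + beta (x_{n_r}^2 - Z); each factor cancels the first
    or the last y and so removes an index, and because K_P(m, n) is
    (m + n + 1) times a function of m times a function of n, the sums of alpha
    and beta over the removed index telescope to K_P again ([drop_transport]).

    In the limit P -> oo the kernels K_P are not dominated by W, but the part of
    either sum with n_r >= M is at most a constant times the sum of
    h_n / x_n^2 over M <= n < P for an explicit h_n depending on P.  This sum is
    bounded, by telescoping, by 2 h_M / M ([sum_peak_le]), whose limit for P -> oo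
    is 2 / (a_M M) = O(M^(-1/2)).  This suffices to compare partial sums in both
    directions ([limit_sum_le]). *)

Set Implicit Arguments.
Unset Strict Implicit.
Unset Printing Implicit Defensive.
Import Order.TTheory GRing.Theory Num.Theory.
Import numFieldNormedType.Exports.
Local Open Scope classical_set_scope.
Local Open Scope ring_scope.

(** * The truncated kernel *)

(** Closes the non-vanishing side conditions left by [field], each being an affine
    expression that is positive or proportional to one known to be nonzero. *)
Ltac nonzero :=
  repeat (apply/andP; split);
  first [ by [] | by rewrite gt_eqF //; lra
        | match goal with h : is_true (_ != 0) |- _ =>
            by apply: contraNneq h => hz; apply/eqP; lra end ].

Section Kernel.
Variable R : realFieldType.
Implicit Types (P m n N l : nat).

Definition node n : R := n%:R + 2^-1.
Definition half_ratio n : R := \prod_(i < n) ((i%:R + 2^-1) / (i%:R + 1)).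

(** [damp] and [boost] are the two corrections that make the finite identity exact;
    for fixed second argument they tend to 1 as P grows.  For P > 0, [boost P n]
    vanishes as soon as n >= P. *)
Definition damp P m : R :=
  \prod_(i < m) ((P%:R + i%:R + 2^-1) / (P%:R + i%:R + 1)).
Definition boost P n : R :=
  \prod_(i < n) ((P%:R - i%:R - 1) / (P%:R - i%:R - 3 / 2)).

Definition head_factor P m : R := half_ratio m * damp P m.
Definition last_factor P n : R := boost P n / (half_ratio n * node n).

(** Since node m + node n = m + n + 1, replacing [damp] and [boost] by 1 gives
    (a_m / a_n) (1 + x_m / x_n). *)
Definition cut_kernel P m n : R :=
  head_factor P m * last_factor P n * (m%:R + n%:R + 1).

Lemma subr_half_neq0 m n : m%:R - n%:R - 2^-1 != 0 :> R.
Proof.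
case: (ltnP n m) => [nm|mn].
  have : n.+1%:R <= m%:R :> R by rewrite ler_nat.
  by rewrite -natr1 => h; rewrite gt_eqF //; lra.
have : m%:R <= n%:R :> R by rewrite ler_nat.
by move=> h; rewrite lt_eqF //; lra.
Qed.

Lemma subr_3half_neq0 m n : m%:R - n%:R - 3 / 2 != 0 :> R.
Proof.
have := subr_half_neq0 m n.+1; rewrite -natr1.
by apply: contraNneq => h; apply/eqP; lra.
Qed.

Lemma node_gt0 n : 0 < node n.
Proof. by rewrite /node; have := ler0n R n; lra. Qed.

Lemma half_ratioS n :
  half_ratio n.+1 = half_ratio n * ((n%:R + 2^-1) / (n%:R + 1)).
Proof. exact: big_ord_recr. Qed.

Lemma dampS P n :
  damp P n.+1 = damp P n * ((P%:R + n%:R + 2^-1) / (P%:R + n%:R + 1)).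
Proof. exact: big_ord_recr. Qed.

Lemma boostS P n :
  boost P n.+1 = boost P n * ((P%:R - n%:R - 1) / (P%:R - n%:R - 3 / 2)).
Proof. exact: big_ord_recr. Qed.

Lemma half_ratio_gt0 n : 0 < half_ratio n.
Proof.
by apply: prodr_gt0 => i _; have := ler0n R i => h; rewrite divr_gt0 //; lra.
Qed.

Lemma boost_over P : boost P.+1 P.+1 = 0.
Proof.
rewrite boostS -(natr1 P) (_ : P%:R + 1 - P%:R - 1 = 0 :> R); last by ring.
by rewrite mul0r mulr0.
Qed.

(** The corrections for the cut-offs P and P + 1 differ by a rational factor,
    because the products telescope in the shift of P. *)
Lemma damp_cut P m : damp P m = damp P.+1 m *
  ((P%:R + 2^-1) * (P%:R + m%:R + 1) / ((P%:R + 1) * (P%:R + m%:R + 2^-1))).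
Proof.
have P0 := ler0n R P.
elim: m => [|m IH].
  by rewrite /damp !big_ord0; field; nonzero.
rewrite dampS IH dampS -(natr1 P) -(natr1 m).
by have m0 := ler0n R m; field; nonzero.
Qed.

Lemma boost_cut P n : (0 < P)%N -> boost P n = boost P.+1 n *
  ((P%:R - 2^-1) * (P%:R - n%:R) / (P%:R * (P%:R - n%:R - 2^-1))).
Proof.
move=> Ppos; have P1 : 1 <= P%:R :> R by rewrite ler1n.
elim: n => [|n IH].
  by rewrite /boost !big_ord0; field; nonzero.
rewrite boostS IH boostS -(natr1 P) -(natr1 n).
have h1 := subr_half_neq0 P n; have h2 := subr_3half_neq0 P n.
have h3 : P%:R + 1 - n%:R - 3 / 2 != 0 :> R.
  by apply: contraNneq h1 => h; apply/eqP; lra.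
have h4 : P%:R - (n%:R + 1) - 2^-1 != 0 :> R.
  by apply: contraNneq h2 => h; apply/eqP; lra.
by field; nonzero.
Qed.

(** Gosper summation: the right-hand side is an explicit antidifference, so the
    proof is the comparison of consecutive values. *)
Lemma sum_head_factor P m : (0 < P)%N ->
  \sum_(l < m) head_factor P.+1 l / (P%:R + l%:R + 2^-1) =
  4 / (2 * P%:R + 1) * (m%:R * (P%:R + m%:R + 1) / (P%:R + m%:R + 2^-1))
    * head_factor P.+1 m.
Proof.
move=> Ppos; have P1 : 1 <= P%:R :> R by rewrite ler1n.
elim: m => [|m IH]; first by rewrite big_ord0 !(mul0r, mulr0).
rewrite big_ord_recr /= IH /head_factor half_ratioS dampS -(natr1 m) -(natr1 P).
by have m0 := ler0n R m; field; nonzero.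
Qed.

Lemma last_factorS P n : last_factor P.+1 n.+1 =
  last_factor P.+1 n * ((P%:R - n%:R) * (n%:R + 1)
    / ((P%:R - n%:R - 2^-1) * (n%:R + 3 / 2))).
Proof.
rewrite /last_factor /node boostS half_ratioS -(natr1 n) -(natr1 P).
have h1 := subr_half_neq0 P n; have n0 := ler0n R n.
have h2 := half_ratio_gt0 n.
by field; nonzero.
Qed.

(** The antidifference here is a multiple of (l + 1/2) [last_factor P.+1 l], which
    vanishes at the upper end l = P + 1. *)
Lemma sum_last_factor P n : (0 < P)%N -> (n <= P)%N ->
  \sum_(n.+1 <= l < P.+1) last_factor P.+1 l / (P%:R - l%:R - 2^-1) =
  - (4 / (2 * P%:R + 1)) * ((P%:R - n%:R) * (n%:R + 1) / (P%:R - n%:R - 2^-1))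
    * last_factor P.+1 n.
Proof.
move=> Ppos nP; have P1 : 1 <= P%:R :> R by rewrite ler1n.
pose u l := 4 / (2 * P%:R + 1) * (l%:R + 2^-1) * last_factor P.+1 l.
rewrite (eq_big_nat _ _ (F2 := fun l => u l.+1 - u l)); last first.
  move=> l _; rewrite /u last_factorS -(natr1 l).
  have h1 := subr_half_neq0 P l; have l0 := ler0n R l.
  by field; nonzero.
rewrite telescope_sumr // /u (_ : last_factor P.+1 P.+1 = 0); last first.
  by rewrite /last_factor boost_over mul0r.
rewrite last_factorS -(natr1 n).
have h1 := subr_half_neq0 P n; have n0 := ler0n R n.
by field; nonzero.
Qed.

(** The ratio between the normalisations of the kernels at P and P + 1, fixed by
    the value 2 of both at (0, 0). *)
Definition cut_scale P : R :=
  (P%:R - 2^-1) * (P%:R + 2^-1) / (P%:R * (P%:R + 1)).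

(** [drop_head] and [drop_last] are the solution (alpha, beta) of the two linear
    equations [drop_sum] and [drop_sum_node]: they split the recursion for the
    kernel into a multiple of x_m^2 - Z and a multiple of x_n^2 - Z. *)
Definition drop_head P m n : R := cut_scale P / 2
  * (head_factor P.+1 m / (P%:R + m%:R + 2^-1))
  * ((P%:R - n%:R) * last_factor P.+1 n).
Definition drop_last P m n : R := - (cut_scale P / 2)
  * ((P%:R + m%:R + 1) * head_factor P.+1 m)
  * (last_factor P.+1 n / (P%:R - n%:R - 2^-1)).

(** Expressing the kernel at P through the factors at P + 1, rather than
    conversely, keeps the formula valid at n = P, where the kernel at P vanishes. *)
Lemma cut_kernel_cut P m n : (0 < P)%N -> cut_kernel P m n =
  cut_scale P * head_factor P.+1 m * last_factor P.+1 n * (m%:R + n%:R + 1)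
  * ((P%:R + m%:R + 1) * (P%:R - n%:R)
     / ((P%:R + m%:R + 2^-1) * (P%:R - n%:R - 2^-1))).
Proof.
move=> Ppos; have P1 : 1 <= P%:R :> R by rewrite ler1n.
rewrite /cut_kernel /head_factor damp_cut /last_factor boost_cut // /cut_scale.
have h1 := subr_half_neq0 P n; have n0 := ler0n R n; have m0 := ler0n R m.
have h2 := half_ratio_gt0 n; have h3 := node_gt0 n.
by field; nonzero.
Qed.

Lemma drop_sum P m n : (0 < P)%N ->
  drop_head P m n + drop_last P m n =
  cut_scale P * cut_kernel P.+1 m n - cut_kernel P m n.
Proof.
move=> Ppos; have P1 : 1 <= P%:R :> R by rewrite ler1n.
rewrite (cut_kernel_cut m n Ppos) /drop_head /drop_last /cut_kernel.
have h1 := subr_half_neq0 P n; have n0 := ler0n R n; have m0 := ler0n R m.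
by field; nonzero.
Qed.

Lemma drop_sum_node P m n : (0 < P)%N ->
  drop_head P m n * node m ^+ 2 + drop_last P m n * node n ^+ 2 =
  cut_scale P * cut_kernel P.+1 m n * node P ^+ 2
  - cut_kernel P m n * P%:R ^+ 2.
Proof.
move=> Ppos; have P1 : 1 <= P%:R :> R by rewrite ler1n.
rewrite (cut_kernel_cut m n Ppos) /drop_head /drop_last /cut_kernel /node.
have h1 := subr_half_neq0 P n; have n0 := ler0n R n; have m0 := ler0n R m.
by field; nonzero.
Qed.

(** Removing the first index with weight alpha or the last one with weight beta
    rebuilds the kernel at P: both sums are telescoping, and their closed forms
    share a denominator over which they add up to a multiple of m + n + 1. *)
Lemma drop_transport P m n : (0 < P)%N -> (n <= P)%N ->
  \sum_(l < m) drop_head P l n + \sum_(n.+1 <= l < P.+1) drop_last P m l =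
  cut_kernel P m n.
Proof.
move=> Ppos nP; have P1 : 1 <= P%:R :> R by rewrite ler1n.
rewrite -mulr_suml -!mulr_sumr sum_head_factor // sum_last_factor //
  cut_kernel_cut //.
have h1 := subr_half_neq0 P n; have n0 := ler0n R n; have m0 := ler0n R m.
by field; nonzero.
Qed.

(** The antidifference vanishes at m = 0 through its factor m and at m = P + 1
    through [boost]. *)
Lemma diag_sum P : (0 < P)%N ->
  \sum_(m < P.+1) (cut_scale P * cut_kernel P.+1 m m - cut_kernel P m m) = 0.
Proof.
move=> Ppos; have P1 : 1 <= P%:R :> R by rewrite ler1n.
pose u m : R := - (cut_scale P * (2 * P%:R + 2^-1) / (P%:R * (P%:R + 2^-1)))
  * (m%:R * (P%:R + m%:R + 1) / (P%:R + m%:R + 2^-1))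
  * damp P.+1 m * boost P.+1 m.
transitivity (\sum_(m < P.+1) (u m.+1 - u m)).
  apply: eq_bigr => -[m _] _ /=.
  rewrite (cut_kernel_cut m m Ppos) /u dampS boostS.
  rewrite /cut_kernel /head_factor /last_factor /node -(natr1 m) -(natr1 P).
  have h1 := subr_half_neq0 P m; have m0 := ler0n R m.
  have h2 := half_ratio_gt0 m.
  by field; nonzero.
rewrite -(big_mkord xpredT (fun m => u m.+1 - u m)) telescope_sumr //.
by rewrite /u boost_over !(mulr0, mul0r) subrr.
Qed.

End Kernel.

(** * Sums over increasing sequences *)

(** The increasing sequences of length r with entries below P, built by adding the
    last entry, so that a sum over them is an iterated sum whose outermost index is
    the largest one; tail estimates concern that index. *)
Fixpoint incseqs (r P : nat) : seq (seq nat) :=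
  if r is r'.+1 then
    [seq rcons s p | p <- iota 0 P, s <- incseqs r' p]
  else [:: [::]].

Lemma big_incseqsS (V : nmodType) r P (F : seq nat -> V) :
  \sum_(s <- incseqs r.+1 P) F s =
  \sum_(p < P) \sum_(s <- incseqs r p) F (rcons s p).
Proof.
by rewrite /= big_allpairs_dep -[P in LHS]subn0 big_mkord.
Qed.

Lemma big_incseqs0 (V : nmodType) P (F : seq nat -> V) :
  \sum_(s <- incseqs 0 P) F s = F [::].
Proof. by rewrite big_seq1. Qed.

Lemma big_incseqsSr (V : nmodType) r P (F : seq nat -> V) :
  \sum_(s <- incseqs r.+1 P.+1) F s =
  \sum_(s <- incseqs r.+1 P) F s + \sum_(s <- incseqs r P) F (rcons s P).
Proof. by rewrite !big_incseqsS big_ord_recr. Qed.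

Lemma mem_incseqs r P t :
  (t \in incseqs r P) = [&& size t == r, sorted ltn t & all (ltn^~ P) t].
Proof.
elim: r P t => [|r IH] P t; first by case: t.
case/lastP: t => [|t p].
  by apply/negbTE/negP => /allpairsPdep[p [[|? ?] []]].
have ltnT : transitive ltn by move=> ? ? ?; apply: ltn_trans.
rewrite size_rcons eqSS all_rcons !(sorted_pairwise ltnT) pairwise_rcons.
rewrite -!(sorted_pairwise ltnT); apply/allpairsPdep/idP.
  move=> [q [u []]]; rewrite mem_iota add0n IH => /andP[_ qP] /and3P[su ou au].
  move=> /rcons_inj[-> ->]; rewrite su ou au /= qP /=.
  by apply: sub_all au => i /= iq; apply: ltn_trans qP.
move=> /and4P[st /andP[tp ot] pP _]; exists p, t.
by split; rewrite ?mem_iota // IH st ot.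
Qed.

Lemma incseqs_uniq r P : uniq (incseqs r P).
Proof.
elim: r P => // r IH P; apply: allpairs_uniq_dep; rewrite ?iota_uniq //.
by move=> [p s] [q t] _ _ /= /rcons_inj[-> ->].
Qed.

(** * The finite identity *)

Section Chains.
Variables (R : realFieldType) (A : comNzRingType) (iota : {rmorphism R -> A}).
Variables (Z : A) (y : nat -> A).
Let z n : A := iota (node R n ^+ 2) - Z.
Hypothesis zy : forall n, z n * y n = 1.

(** [chain s m n] is the sum of y_{n_1} ... y_{n_(s+1)} over the increasing sequences
    from n_1 = m to n_(s+1) = n ([sum_chain]). *)
Fixpoint chain (s m n : nat) : A :=
  if s is s'.+1 then y n * \sum_(l < n) chain s' m l
  else if m == n then y n else 0.

Lemma chain0 m n : chain 0 m n = if m == n then y n else 0. Proof. by []. Qed.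
Lemma chainS s m n : chain s.+1 m n = y n * \sum_(l < n) chain s m l.
Proof. by []. Qed.

Lemma chain_out s m n : (n < m)%N -> chain s m n = 0.
Proof.
elim: s n => [|s IH] n nm; first by rewrite chain0 gtn_eqF.
by rewrite chainS big1 ?mulr0 // => l _; rewrite IH // (ltn_trans _ nm).
Qed.

Lemma chain_drop_last s m n : z n * chain s.+1 m n = \sum_(l < n) chain s m l.
Proof. by rewrite chainS mulrA zy mul1r. Qed.

Lemma sum_chain0 P m : \sum_(l < P) chain 0 m l = if (m < P)%N then y m else 0.
Proof.
rewrite /= -big_mkcond /=; case: ltnP => mP.
  by rewrite (big_pred1 (Ordinal mP)) // => i; rewrite eq_sym -val_eqE.
rewrite big_pred0 // => i; apply/negbTE.
by rewrite neq_ltn (leq_trans (ltn_ord i) mP) orbT.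
Qed.

(** Multiplying by z m cancels y_m, and the remaining sequence starts anywhere
    above m.  For [chain_drop_last] this is the definition; here it goes through
    the recursion on the last index. *)
Lemma chain_drop_head s m n P : (n < P)%N ->
  z m * chain s.+1 m n = \sum_(l < P | (m < l)%N) chain s l n.
Proof.
elim: s n => [|s IH] n nP.
  rewrite chainS sum_chain0; under [RHS]eq_bigr do rewrite chain0.
  rewrite -big_mkcondr; case: ltnP => mn.
    rewrite mulrCA zy mulr1 (big_pred1 (Ordinal nP)) // => i /=.
    by rewrite -val_eqE /=; case: eqVneq => [->|_]; rewrite ?mn ?andbF.
  rewrite !mulr0 big_pred0 // => i.
  case: eqVneq => [->|_]; last by rewrite andbF.
  by rewrite ltnNge mn.
rewrite (chainS s.+1) mulrCA mulr_sumr.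
under eq_bigr => l _ do rewrite (IH l (ltn_trans (ltn_ord l) nP)).
transitivity (\sum_(l < P | (m < l)%N) y n * \sum_(i < n) chain s l i) => //.
by rewrite -mulr_sumr exchange_big.
Qed.

Definition headlast_sum (P s : nat) (F : nat -> nat -> R) : A :=
  \sum_(m < P) \sum_(n < P) iota (F m n) * chain s m n.

(** Two linear relations between the coefficients suffice for an identity affine
    in Z: compare constant terms and coefficients of Z. *)
Lemma node_split (s p q a b d e m n : R) (c : A) :
  d + e = s * a - b -> d * m + e * n = s * a * p - b * q ->
  iota s * (iota p - Z) * (iota a * c) - (iota q - Z) * (iota b * c) =
  iota d * ((iota m - Z) * c) + iota e * ((iota n - Z) * c).
Proof.
move=> /(congr1 iota) e1 /(congr1 iota) e2.
move: e1 e2; rewrite !rmorphB !rmorphD !rmorphM => e1 e2.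
transitivity ((iota d * iota m + iota e * iota n) * c
    - (iota d + iota e) * (Z * c)); last by ring.
by rewrite e1 e2; ring.
Qed.

(** The coefficient of each chain in the difference of the two outer terms is
    alpha z_m + beta z_n; dropping the first and the last index and exchanging sums
    collects, at each shorter chain, the sum computed by [drop_transport]. *)
Lemma headlast_sum_step P s : (0 < P)%N ->
  iota (cut_scale R P) * z P * headlast_sum P.+1 s.+1 (cut_kernel R P.+1) =
  headlast_sum P s (cut_kernel R P)
  + (iota (P%:R ^+ 2) - Z) * headlast_sum P s.+1 (cut_kernel R P).
Proof.
move=> Ppos.
(* The kernel at P vanishes at n = P and chains vanish for m > n, so both sums
   may be taken over the indices up to P. *)
have ext k : headlast_sum P k (cut_kernel R P) =
    headlast_sum P.+1 k (cut_kernel R P).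
  have cut0 m : iota (cut_kernel R P m P) = 0.
    by rewrite cut_kernel_cut // subrr !(mulr0, mul0r) rmorph0.
  rewrite [RHS]big_ord_recr /= [X in _ + X]big1 ?addr0; last first.
    move=> n _; have [Pn|nP] := leqP P n; last by rewrite chain_out // mulr0.
    suff -> : n = P :> nat by rewrite cut0 mul0r.
    by apply/eqP; rewrite eqn_leq Pn -ltnS ltn_ord.
  by apply: eq_bigr => m _; rewrite big_ord_recr /= cut0 mul0r addr0.
rewrite !ext; apply/eqP; rewrite -subr_eq; apply/eqP.
transitivity (\sum_(m < P.+1) \sum_(n < P.+1)
   (iota (drop_head R P m n) * (z m * chain s.+1 m n)
    + iota (drop_last R P m n) * (z n * chain s.+1 m n))).
  rewrite /headlast_sum !mulr_sumr -sumrB; apply: eq_bigr => m _.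
  rewrite !mulr_sumr -sumrB; apply: eq_bigr => n _.
  by apply: node_split; [exact: drop_sum|exact: drop_sum_node].
rewrite /headlast_sum.
under eq_bigr do rewrite big_split /=; rewrite big_split /=.
transitivity (\sum_(n < P.+1) \sum_(l < P.+1)
    (iota (\sum_(m < l) drop_head R P m n) * chain s l n) +
   \sum_(m < P.+1) \sum_(l < P.+1)
    (iota (\sum_(l.+1 <= n < P.+1) drop_last R P m n) * chain s m l)).
  congr (_ + _).
    rewrite exchange_big; apply: eq_bigr => n _ /=.
    under eq_bigr => m _ do rewrite (chain_drop_head _ _ (ltn_ord n)) mulr_sumr.
    rewrite (exchange_big_dep xpredT) //=; apply: eq_bigr => l _.
    rewrite -mulr_suml -rmorph_sum; congr (iota _ * _).
    have lP := ltnW (ltn_ord l).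
    by rewrite [RHS](big_ord_widen P.+1 (drop_head R P ^~ n) lP).
  apply: eq_bigr => m _.
  under eq_bigr => n _ do rewrite chain_drop_last mulr_sumr
    (big_ord_widen P.+1 (fun l => iota (drop_last R P m n) * chain s m l)
       (ltnW (ltn_ord n))).
  rewrite (exchange_big_dep xpredT) //=; apply: eq_bigr => l _.
  by rewrite -mulr_suml -rmorph_sum; congr (iota _ * _); rewrite big_geq_mkord.
rewrite exchange_big -big_split; apply: eq_bigr => m _ /=.
rewrite -big_split; apply: eq_bigr => n _ /=.
by rewrite -mulrDl -rmorphD drop_transport // -ltnS.
Qed.

Definition elem_sum r P : A := \sum_(s <- incseqs r P) \prod_(i <- s) y i.

Definition marked_sum r P (v : nat -> A) : A :=
  \sum_(s <- incseqs r P) (\sum_(i <- s) v i) * \prod_(i <- s) y i.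

Lemma elem_sum0 P : elem_sum 0 P = 1.
Proof. by rewrite /elem_sum big_incseqs0 big_nil. Qed.

Lemma elem_sumS r P :
  elem_sum r.+1 P.+1 = elem_sum r.+1 P + y P * elem_sum r P.
Proof.
rewrite /elem_sum big_incseqsSr mulr_sumr; congr (_ + _).
by apply: eq_bigr => s _; rewrite big_rcons mulrC.
Qed.

Lemma marked_sum0 P v : marked_sum 0 P v = 0.
Proof. by rewrite /marked_sum big_incseqs0 !big_nil mul0r. Qed.

Lemma marked_sumn0 r v : marked_sum r 0 v = 0.
Proof. by case: r => [|r]; rewrite ?marked_sum0 // /marked_sum big_nil. Qed.

Lemma marked_sumS r P v : marked_sum r.+1 P.+1 v =
  marked_sum r.+1 P v + y P * (marked_sum r P v + v P * elem_sum r P).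
Proof.
rewrite /marked_sum big_incseqsSr; congr (_ + _).
rewrite /elem_sum mulr_sumr -big_split mulr_sumr; apply: eq_bigr => s _.
by rewrite !big_rcons /=; ring.
Qed.

Lemma marked_sumB r P v w :
  marked_sum r P (fun n => v n - w n) = marked_sum r P v - marked_sum r P w.
Proof.
by rewrite /marked_sum -sumrB; apply: eq_bigr => s _; rewrite sumrB mulrBl.
Qed.

Lemma marked_sumM r P c v :
  marked_sum r P (fun n => c * v n) = c * marked_sum r P v.
Proof.
rewrite /marked_sum mulr_sumr; apply: eq_bigr => s _.
by rewrite -mulr_sumr mulrA.
Qed.

(** Marking an index with weight z u cancels its y; what remains is a shorter
    sequence together with an index outside it, that is, all indices minus those
    that belong to the sequence. *)
Lemma marked_sum_node r P (u : nat -> A) :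
  marked_sum r.+1 P (fun n => z n * u n) =
  (\sum_(n < P) u n) * elem_sum r P - marked_sum r P u.
Proof.
elim: P r => [|P IH] r; first by rewrite !marked_sumn0 big_ord0 mul0r subr0.
rewrite marked_sumS IH big_ord_recr /=.
case: r => [|r].
  rewrite !marked_sum0 !elem_sum0.
  transitivity ((\sum_(n < P) u n) + (z P * y P) * u P); first by ring.
  by rewrite zy; ring.
rewrite IH !marked_sumS !elem_sumS.
transitivity ((\sum_(n < P) u n) * elem_sum r.+1 P - marked_sum r.+1 P u +
  (y P * ((\sum_(n < P) u n) * elem_sum r P - marked_sum r P u)
   + (z P * y P) * u P * elem_sum r.+1 P)); first by ring.
by rewrite zy; ring.
Qed.

Definition diag_weight P n : A := iota (cut_kernel R P n n).

(** Same recursion as [headlast_sum_step].  Passing from the diagonal weights at P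
    to the rescaled ones at P + 1 multiplies by z up to an error u, to which
    [marked_sum_node] applies; the total of u over the indices up to P vanishes by
    [diag_sum], which removes every unmarked sum. *)
Lemma marked_sum_step r P : (0 < P)%N ->
  iota (cut_scale R P) * z P * marked_sum r.+1 P.+1 (diag_weight P.+1) =
  marked_sum r P (diag_weight P)
  + (iota (P%:R ^+ 2) - Z) * marked_sum r.+1 P (diag_weight P).
Proof.
move=> Ppos.
pose k' n := iota (cut_scale R P) * diag_weight P.+1 n.
pose u n := k' n - diag_weight P n.
have kP : diag_weight P P = 0.
  by rewrite /diag_weight cut_kernel_cut // subrr !(mulr0, mul0r) rmorph0.
have sumu : \sum_(n < P) u n = - k' P.
  have : \sum_(n < P.+1) u n = 0.
    rewrite -[RHS](rmorph0 iota) -(diag_sum R Ppos) rmorph_sum.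
    by apply: eq_bigr => n _; rewrite rmorphB rmorphM.
  by rewrite big_ord_recr /= {2}/u kP subr0 => /eqP; rewrite addr_eq0 => /eqP.
have nodeu n :
    z P * k' n - (iota (P%:R ^+ 2) - Z) * diag_weight P n = z n * u n.
  have := node_split 1 (drop_sum R n n Ppos) (drop_sum_node R n n Ppos).
  rewrite -mulrDl !mulr1 -rmorphD drop_sum // rmorphB.
  rewrite (rmorphM iota (cut_scale R P)).
  rewrite -/(diag_weight P n) -/(diag_weight P.+1 n) -/(k' n) -/(u n).
  rewrite [RHS]mulrC => <-.
  by rewrite /k' /z; ring.
have := marked_sum_node r P u.
rewrite sumu (_ : marked_sum r.+1 P _ =
    marked_sum r.+1 P (fun n =>
      z P * k' n - (iota (P%:R ^+ 2) - Z) * diag_weight P n)); last first.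
  by apply: eq_bigr => s _; congr (_ * _); apply: eq_bigr => n _.
rewrite marked_sumB (marked_sumM _ _ _ k') (marked_sumM _ _ _ (diag_weight P)).
rewrite (marked_sumB _ _ k') => e.
transitivity (z P * marked_sum r.+1 P.+1 k').
  by rewrite marked_sumM; ring.
rewrite marked_sumS mulrDr (mulrA (z P) (y P)) zy mul1r.
by move/eqP: e; rewrite subr_eq => /eqP ->; rewrite /k'; ring.
Qed.

Lemma headlast_sum1 P :
  headlast_sum P 0 (cut_kernel R P) = marked_sum 1 P (diag_weight P).
Proof.
rewrite /marked_sum big_incseqsS; apply: eq_bigr => m _.
rewrite big_incseqs0 /= !big_seq1 (bigD1 m) //= eqxx big1 ?addr0 // => n nm.
by rewrite (val_eqE m n) eq_sym (negbTE nm) mulr0.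
Qed.

(** The common recursion determines the value at P + 1 since its leading factor is
    invertible, with inverse y. *)
Lemma headlast_sum_eq r P : (0 < P)%N ->
  headlast_sum P r (cut_kernel R P) = marked_sum r.+1 P (diag_weight P).
Proof.
case: P => // P _; elim: P r => [|P IH] [|r]; rewrite ?headlast_sum1 //.
  rewrite /headlast_sum !big_ord1 chainS big_ord0 mulr0 mulr0.
  by rewrite /marked_sum big_incseqsS big_ord1 big_incseqsS big_ord0.
have : iota (cut_scale R P.+1) * z P.+1
    * headlast_sum P.+2 r.+1 (cut_kernel R P.+2) =
  iota (cut_scale R P.+1) * z P.+1 * marked_sum r.+2 P.+2 (diag_weight P.+2).
  by rewrite headlast_sum_step // marked_sum_step // !IH.
have cs0 : cut_scale R P.+1 != 0.
  have P1 : 1 <= P.+1%:R :> R by rewrite ler1n.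
  by rewrite gt_eqF // /cut_scale divr_gt0 // mulr_gt0 //; lra.
move/(congr1 (fun t => iota (cut_scale R P.+1)^-1 * y P.+1 * t)).
have cancel t : iota (cut_scale R P.+1)^-1 * y P.+1 *
    (iota (cut_scale R P.+1) * z P.+1 * t) = t.
  transitivity (iota ((cut_scale R P.+1)^-1 * cut_scale R P.+1)
     * (z P.+1 * y P.+1) * t); first by rewrite (rmorphM iota _^-1); ring.
  by rewrite zy mulVf // rmorph1 !mul1r.
by rewrite !cancel.
Qed.

Lemma sum_chain (phi : nat -> A) s n P : (n < P)%N ->
  \sum_(m < P) phi m * chain s m n =
  y n * \sum_(t <- incseqs s n) phi (head n t) * \prod_(i <- t) y i.
Proof.
elim: s n => [|s IH] n nP.
  rewrite big_incseqs0 big_nil mulr1 (bigD1 (Ordinal nP)) //= eqxx big1.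
    by rewrite addr0 mulrC.
  by move=> m; rewrite -val_eqE /= => /negbTE->; rewrite mulr0.
under eq_bigr do rewrite chainS mulrCA mulr_sumr.
rewrite -mulr_sumr exchange_big big_incseqsS; congr (_ * _).
apply: eq_bigr => m _; rewrite IH ?(ltn_trans (ltn_ord m)) // mulr_sumr.
apply: eq_bigr => t _; rewrite big_rcons mulrCA (mulrC (y _)) mulrA.
by case: t => [|t0 t] /=; rewrite ?mulrA.
Qed.

(** [headlast_sum_eq], with the chains expanded back into sequences; the last entry
    is split off because [sum_chain] fixes it. *)
Theorem cut_identity r P : (0 < P)%N ->
  \sum_(t <- incseqs r.+1 P)
     iota (cut_kernel R P (head 0%N t) (last 0%N t)) * \prod_(i <- t) y i =
  \sum_(t <- incseqs r.+1 P)
     iota (\sum_(i <- t) cut_kernel R P i i) * \prod_(i <- t) y i.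
Proof.
move=> Ppos; under [RHS]eq_bigr do rewrite rmorph_sum.
rewrite -[RHS](headlast_sum_eq r Ppos) /headlast_sum exchange_big big_incseqsS.
apply: eq_bigr => n _ /=.
rewrite (sum_chain (fun m => iota (cut_kernel R P m n)) _ (ltn_ord n)).
rewrite mulr_sumr.
apply: eq_bigr => t _; rewrite big_rcons last_rcons.
rewrite (_ : head 0%N (rcons t (n : nat)) = head (n : nat) t) /=;
  last by case: t.
by ring.
Qed.

End Chains.

(** * Extracting the coefficient of a power of Z *)

Section Coefficients.
Variable R : realFieldType.

Definition node_monomial r k (c : r.-tuple 'I_k.+1) (t : seq nat) : R :=
  (\prod_(i < r) node R (nth 0%N t i) ^+ (2 * tnth c i))^-1.

Definition composition_sum (r k : nat) (t : seq nat) : R :=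
  \sum_(c : r.-tuple 'I_k.+1 | is_composition c) node_monomial c t.

(** The expansion of 1 / (x_n^2 - Z), truncated so as to be an inverse modulo Z^k. *)
Definition inv_series (k n : nat) : {poly R} :=
  \sum_(c < k.+1 | (0 < c)%N) (node R n ^+ (2 * c))^-1 *: 'X^(c.-1).

Lemma inv_seriesE k n :
  ((node R n ^+ 2)%:P - 'X) * inv_series k n = 1 - (node R n ^+ (2 * k))^-1 *: 'X^k.
Proof.
have x0 := lt0r_neq0 (node_gt0 R n).
have -> : inv_series k n = \sum_(c < k) (node R n ^+ (2 * c.+1))^-1 *: 'X^c.
  by rewrite /inv_series big_mkcond big_ord_recl /= add0r.
pose u c : {poly R} := (node R n ^+ (2 * c))^-1 *: 'X^c.
rewrite mulr_sumr (eq_bigr (fun c : 'I_k => - (u c.+1 - u c))).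
  rewrite sumrN -(big_mkord xpredT (fun c => u c.+1 - u c)) telescope_sumr //.
  by rewrite opprB /u muln0 expr0 invr1 scale1r.
move=> c _; rewrite mulrBl opprB.
have -> : 'X * ((node R n ^+ (2 * c.+1))^-1 *: 'X^c) = u c.+1.
  by rewrite /u exprS -scalerAr.
rewrite /u mul_polyC scalerA.
congr (_ *: _ - _); rewrite mulnS exprD invfM mulrA mulfV ?mul1r //.
exact: expf_neq0.
Qed.

(** Choosing a term of exponent c_i - 1 in each factor contributes to the
    coefficient k - r exactly when the c_i add up to k. *)
Lemma coef_prod_inv_series r k (t : seq nat) : (r <= k)%N -> size t = r ->
  (\prod_(n <- t) inv_series k n)`_(k - r) = composition_sum r k t.
Proof.
move=> rk st; rewrite (big_nth 0%N) st big_mkord /inv_series.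
rewrite (bigA_distr_big (fun c : 'I_k.+1 => 0 < c)%N) coef_sum.
transitivity (\sum_(f : {ffun 'I_r -> 'I_k.+1} |
    f \in ffun_on (fun c : 'I_k.+1 => 0 < c)%N)
   if (\sum_i f i == k)%N then
     (\prod_(i < r) node R (nth 0%N t i) ^+ (2 * f i))^-1 else 0).
  apply: eq_bigr => f /ffun_onP f0.
  rewrite scaler_prod -expr_sum coefZ coefXn prodfV.
  have -> : (k - r == \sum_i (f i).-1)%N = (\sum_i f i == k)%N.
    have -> : (\sum_i f i = \sum_i (f i).-1 + r)%N.
      rewrite -[X in (_ + X)%N]card_ord -sum1_card -big_split.
      by apply: eq_bigr => i _; rewrite /= addn1 prednK //; exact: f0.
    by rewrite -(eqn_add2r r) subnK // eq_sym.
  by case: eqP; rewrite ?mulr1 ?mulr0.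
rewrite -big_mkcondr /composition_sum /=.
rewrite [RHS](reindex (fun f : {ffun 'I_r -> 'I_k.+1} =>
  [tuple f i | i < r])) /=.
  apply: eq_big => [f|f _].
    rewrite /is_composition; congr (_ && _).
      by apply/ffun_onP/forallP => f0 i; have := f0 i; rewrite tnth_mktuple.
    by congr (_ == _); apply: eq_bigr => i _; rewrite tnth_mktuple.
  by congr (_^-1); apply: eq_bigr => i _; rewrite tnth_mktuple.
exists (fun u => [ffun i => tnth u i]) => [f _|u _].
  by apply/ffunP => i; rewrite ffunE tnth_mktuple.
by apply: eq_from_tnth => i; rewrite tnth_mktuple ffunE.
Qed.

(** [cut_identity] in the quotient by Z^k, which preserves the coefficient of
    index k - r - 1 since this is less than k. *)
Lemma cut_identity_coef r k P : (r < k)%N -> (0 < P)%N ->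
  \sum_(t <- incseqs r.+1 P)
     cut_kernel R P (head 0%N t) (last 0%N t) * composition_sum r.+1 k t =
  \sum_(t <- incseqs r.+1 P)
     (\sum_(i <- t) cut_kernel R P i i) * composition_sum r.+1 k t.
Proof.
move=> rk Ppos.
pose h : {poly R} := 'X^k; pose B := {poly %/ h}.
pose iota : {rmorphism R -> B} := (in_qpoly h \o polyC : {rmorphism R -> B}).
pose y n : B := in_qpoly h (inv_series k n).
have zy n : (iota (node R n ^+ 2) - in_qpoly h 'X) * y n = 1.
  rewrite -[iota _]/(in_qpoly h (node R n ^+ 2)%:P) -rmorphB -rmorphM inv_seriesE.
  have h0 : in_qpoly h 'X^k = 0.
    apply: val_inj => /=.
    rewrite /h mk_monic_Xn prednK ?(leq_ltn_trans _ rk) //.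
    by rewrite Pdiv.RingMonic.rmodpp // monicXn.
  by rewrite rmorphB rmorph1 /= in_qpolyZ h0 scaler0 subr0.
have lift (f : seq nat -> R) :
    \sum_(t <- incseqs r.+1 P) iota (f t) * \prod_(i <- t) y i =
    in_qpoly h (\sum_(t <- incseqs r.+1 P) f t *: \prod_(n <- t) inv_series k n).
  rewrite rmorph_sum; apply: eq_bigr => t _.
  by rewrite -mul_polyC rmorphM rmorph_prod.
have := @cut_identity R B iota _ y zy r P Ppos.
rewrite !lift => /(congr1 (fun q : B => (q : {poly R})`_(k - r.+1))).
have coefh (q : {poly R}) :
    (in_qpoly h q : {poly R})`_(k - r.+1) = q`_(k - r.+1).
  have k0 : (0 < k)%N by apply: leq_ltn_trans rk.
  rewrite /= /h mk_monic_Xn prednK // -Pdiv.RingMonic.take_poly_rmodp.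
  by rewrite coef_take_poly ltn_subrL k0.
rewrite !coefh !coef_sum.
have coefE (f : seq nat -> R) :
  \sum_(t <- incseqs r.+1 P) (f t *: \prod_(n <- t) inv_series k n)`_(k - r.+1) =
  \sum_(t <- incseqs r.+1 P) f t * composition_sum r.+1 k t.
  rewrite big_seq [RHS]big_seq; apply: eq_bigr => t tP.
  move: tP; rewrite mem_incseqs => /and3P[/eqP st _ _].
  by rewrite coefZ coef_prod_inv_series.
by rewrite !coefE.
Qed.

End Coefficients.

(** * Bounds uniform in the cut-off *)

Section Bounds.
Variable R : realFieldType.
Implicit Types (P M m n i : nat).

(** Up to a factor 2 this dominates both the kernel with last index n and its
    diagonal at the indices up to n.  For n close to P it is of order n, so that its
    supremum over P is too large to be summed against 1 / x_n^2. *)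
Definition peak P n : R := boost R P n / half_ratio R n.

Lemma half_ratio_le1 n : half_ratio R n <= 1.
Proof.
apply: prodr_ile1 => i _; have i0 := ler0n R i.
by rewrite divr_ge0 ?ler_pdivrMr; lra.
Qed.

Lemma damp_ge0 P m : 0 <= damp R P m.
Proof.
apply: prodr_ge0 => i _; have i0 := ler0n R i; have P0 := ler0n R P.
by rewrite divr_ge0; lra.
Qed.

Lemma damp_le1 P m : damp R P m <= 1.
Proof.
apply: prodr_ile1 => i _; have i0 := ler0n R i; have P0 := ler0n R P.
by rewrite divr_ge0 ?ler_pdivrMr; lra.
Qed.

Lemma boost_eq0 P : (0 < P)%N -> boost R P P = 0.
Proof. by case: P => // P _; exact: boost_over. Qed.

Lemma boost_leS P n : (n.+1 < P)%N -> 1 <= boost R P n ->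
  boost R P n <= boost R P n.+1.
Proof.
move=> nP b1; rewrite boostS ler_peMr ?(le_trans ler01) //.
have : n.+2%:R <= P%:R :> R by rewrite ler_nat.
rewrite -(natr1 n.+1) -(natr1 n) => h.
by rewrite ler_pdivlMr; lra.
Qed.

Lemma boost_ge1 P n : (n < P)%N -> 1 <= boost R P n.
Proof.
elim: n => [|n IH] nP; first by rewrite /boost big_ord0.
by apply: le_trans (boost_leS nP _); exact: IH (ltnW nP).
Qed.

Lemma boost_le P i n : (i <= n)%N -> (n < P)%N -> boost R P i <= boost R P n.
Proof.
elim: n => [|n IH]; first by rewrite leqn0 => /eqP->.
rewrite leq_eqVlt ltnS => /predU1P[->//|le_in] nP.
by apply: le_trans (IH le_in (ltnW nP)) (boost_leS nP (boost_ge1 (ltnW nP))).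
Qed.

Lemma boost_ge0 P n : (n <= P)%N -> (0 < P)%N -> 0 <= boost R P n.
Proof.
rewrite leq_eqVlt => /predU1P[->|nP] P0; first by rewrite boost_eq0.
exact: le_trans (boost_ge1 nP).
Qed.

Lemma peak_ge0 P n : (n <= P)%N -> (0 < P)%N -> 0 <= peak P n.
Proof. by move=> nP P0; rewrite divr_ge0 ?boost_ge0 // ltW ?half_ratio_gt0. Qed.

Lemma boost_le_peak P n : (n < P)%N -> boost R P n <= peak P n.
Proof.
move=> nP; rewrite ler_pdivlMr ?half_ratio_gt0 // ler_piMr ?half_ratio_le1 //.
exact: le_trans (boost_ge1 nP).
Qed.

Lemma cut_kernel_ge0 P m n : (n < P)%N -> 0 <= cut_kernel R P m n.
Proof.
move=> nP; have P0 := leq_ltn_trans (leq0n n) nP.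
rewrite /cut_kernel /head_factor /last_factor.
rewrite !mulr_ge0 ?damp_ge0 ?boost_ge0 ?invr_ge0 //.
- exact: ltW (half_ratio_gt0 _ _).
- exact: ltnW.
- by rewrite mulr_ge0 // ltW ?half_ratio_gt0 ?node_gt0.
Qed.

Lemma cut_kernel_le_peak P m n :
  (m <= n < P)%N -> cut_kernel R P m n <= 2 * peak P n.
Proof.
move=> /andP[mn nP]; have P0 := leq_ltn_trans (leq0n n) nP.
have a0 := half_ratio_gt0 R n; have x0 := node_gt0 R n.
have -> : cut_kernel R P m n =
    head_factor R P m * (((m%:R + n%:R + 1) / node R n) * peak P n).
  by rewrite /cut_kernel /last_factor /peak; field; nonzero.
have le2 : (m%:R + n%:R + 1) / node R n <= 2.
  rewrite ler_pdivrMr // /node; have : m%:R <= n%:R :> R by rewrite ler_nat.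
  lra.
have ge0 : 0 <= (m%:R + n%:R + 1) / node R n.
  by rewrite divr_ge0 ?ltW // -natrD natr1 ler0n.
have p0 := peak_ge0 (ltnW nP) P0.
have h0 : 0 <= head_factor R P m.
  by rewrite mulr_ge0 ?damp_ge0 // ltW ?half_ratio_gt0.
have h1 : head_factor R P m <= 1.
  rewrite mulr_ile1 ?half_ratio_le1 ?damp_le1 ?damp_ge0 //.
  by rewrite ltW ?half_ratio_gt0.
rewrite -[leRHS]mul1r; apply: ler_pM => //; first exact: mulr_ge0.
exact: ler_wpM2r.
Qed.

Lemma cut_kernel_diag P i : cut_kernel R P i i = 2 * damp R P i * boost R P i.
Proof.
have a0 := half_ratio_gt0 R i; have i0 := ler0n R i.
by rewrite /cut_kernel /last_factor /head_factor /node; field; nonzero.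
Qed.

Lemma cut_kernel_diag_le_peak P i n :
  (i <= n < P)%N -> cut_kernel R P i i <= 2 * peak P n.
Proof.
move=> /andP[le_in nP]; rewrite cut_kernel_diag -mulrA ler_pM2l ?ltr0n //.
apply: le_trans (boost_le_peak nP); apply: le_trans (boost_le le_in nP).
rewrite ler_piMl ?damp_le1 //.
by rewrite (le_trans _ (boost_ge1 (leq_ltn_trans le_in nP))).
Qed.

(** The summand is at most peak P n / (n (n + 1/2)), because x_n^2 > n (n + 1/2), and
    this has an antidifference proportional to peak P n (P - n - 1/2) / n, which
    vanishes at n = P. *)
Lemma sum_peak_le P M : (0 < M <= P)%N ->
  \sum_(M <= n < P) peak P n / node R n ^+ 2 <= 2 * peak P M / M%:R.
Proof.
move=> /andP[M0 MP]; have P0 := leq_trans M0 MP.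
have P1 : 1 <= P%:R :> R by rewrite ler1n.
have M1 : 1 <= M%:R :> R by rewrite ler1n.
pose u n := - (peak P n * (P%:R - n%:R - 2^-1) / (n%:R * (P%:R / 2 - 4^-1))).
apply: (@le_trans _ _ (\sum_(M <= n < P) (u n.+1 - u n))).
  rewrite big_nat [leRHS]big_nat; apply: ler_sum => n /andP[Mn nP].
  have n1 : 1 <= n%:R :> R by rewrite ler1n (leq_trans M0).
  have -> : u n.+1 - u n = peak P n / (n%:R * (n%:R + 2^-1)).
    rewrite /u /peak boostS half_ratioS -(natr1 n).
    have a0 := half_ratio_gt0 R n; have h := subr_3half_neq0 R P n.
    by field; nonzero.
  rewrite ler_wpM2l ?peak_ge0 ?(ltnW nP) // lef_pV2 ?posrE /node; last 2 first.
  - by rewrite exprn_gt0 //; lra.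
  - by rewrite mulr_gt0 //; lra.
  by rewrite expr2; nra.
rewrite telescope_sumr // /u {1}/peak boost_eq0 // !mul0r oppr0 sub0r opprK.
have p0 := peak_ge0 MP P0.
have -> : 2 * peak P M / M%:R =
    peak P M * (P%:R - 2^-1) / (M%:R * (P%:R / 2 - 4^-1)).
  by field; nonzero.
have d0 : 0 <= (M%:R * (P%:R / 2 - 4^-1))^-1 :> R.
  by rewrite invr_ge0 mulr_ge0 //; lra.
by rewrite ler_wpM2r // ler_wpM2l //; lra.
Qed.

(** The central binomial estimate a_n >= 1 / (2 sqrt n), squared to stay rational. *)
Lemma half_ratio_sqr_ge n : (0 < n)%N -> (4 * n%:R)^-1 <= half_ratio R n ^+ 2.
Proof.
case: n => // n _; elim: n => [|n IH].
  rewrite half_ratioS /half_ratio big_ord0.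
  by rewrite le_eqVlt; apply/orP; left; apply/eqP; field.
rewrite half_ratioS exprMn.
have n0 := ler0n R n.+1; have n1 : 1 <= n.+1%:R :> R by rewrite ler1n.
have s0 : 0 <= ((n.+1%:R + 2^-1) / (n.+1%:R + 1)) ^+ 2 :> R by rewrite sqr_ge0.
apply: le_trans (ler_wpM2r s0 IH); rewrite -(natr1 n.+1) -subr_ge0.
set x : R := n.+1%:R in n0 n1 *.
have -> : (4 * x)^-1 * ((x + 2^-1) / (x + 1)) ^+ 2 - (4 * (x + 1))^-1 =
  (16 * x * (x + 1) ^+ 2)^-1 by field; nonzero.
by rewrite invr_ge0 !mulr_ge0 ?sqr_ge0 //; lra.
Qed.

(** 1 / x_n^2 <= 1/n - 1/(n+1) for n > 0; the term n = 0 is 4. *)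
Lemma sum_node_inv P : \sum_(n < P) (node R n ^+ 2)^-1 <= 5.
Proof.
case: P => [|P]; first by rewrite big_ord0.
apply: (@le_trans _ _ (5 - (P%:R + 1)^-1)); last first.
  by rewrite gerBl invr_ge0; have := ler0n R P; lra.
elim: P => [|P IH].
  rewrite big_ord1 /= /node le_eqVlt.
  by apply/orP; left; apply/eqP; field.
rewrite big_ord_recr /=; apply: le_trans (lerD IH (lexx _)) _.
rewrite /node -(natr1 P) -subr_ge0; have P0 := ler0n R P.
set x : R := P%:R in P0 *.
have -> : 5 - (x + 1 + 1)^-1 - (5 - (x + 1)^-1 + ((x + 1 + 2^-1) ^+ 2)^-1) =
   (4 * (x + 1) * (x + 2) * (x + 3 / 2) ^+ 2)^-1 by field; nonzero.
by rewrite invr_ge0 !mulr_ge0 ?sqr_ge0 //; lra.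
Qed.

Lemma sum_incseqs_prod_le (g : nat -> R) B r P :
  (forall n, 0 <= g n) -> (forall M, \sum_(n < M) g n <= B) ->
  \sum_(t <- incseqs r P) \prod_(i <- t) g i <= B ^+ r.
Proof.
move=> g0 gB; have B0 : 0 <= B by have := gB 0%N; rewrite big_ord0.
elim: r P => [|r IH] P; first by rewrite big_incseqs0 big_nil.
rewrite big_incseqsS.
apply: (@le_trans _ _ (\sum_(p < P) g p * B ^+ r)).
  apply: ler_sum => p _; rewrite (eq_bigr (fun t => g p * \prod_(i <- t) g i)).
    by rewrite -mulr_sumr ler_wpM2l.
  by move=> t _; rewrite big_rcons mulrC.
by rewrite -mulr_suml exprS ler_wpM2r ?exprn_ge0.
Qed.

(** Sequences counted at cut-off P but not at M have last entry at least M; the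
    other entries contribute at most 5 each by [sum_node_inv]. *)
Lemma sum_incseqs_tail (r P M : nat) (D D' : R) (C w : seq nat -> R) :
  (0 < M <= P)%N -> 0 <= D -> 0 <= D' ->
  (forall t, size t = r.+1 -> 0 <= C t <= D * \prod_(i <- t) (node R i ^+ 2)^-1) ->
  (forall t, t \in incseqs r.+1 P -> w t <= D' * peak P (last 0%N t)) ->
  \sum_(t <- incseqs r.+1 P) w t * C t <=
  \sum_(t <- incseqs r.+1 M) w t * C t
    + 2 * D' * D * 5 ^+ r * (peak P M / M%:R).
Proof.
move=> MP D0 D'0 CD wD'; have [M0 leMP] := andP MP.
have P0 := leq_trans M0 leMP.
have byLast N : \sum_(t <- incseqs r.+1 N) w t * C t =
    \sum_(0 <= p < N) \sum_(s <- incseqs r p) w (rcons s p) * C (rcons s p).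
  by rewrite big_incseqsS big_mkord.
rewrite !byLast.
rewrite (big_cat_nat (n := M)) //= lerD2l.
have -> : 2 * D' * D * 5 ^+ r * (peak P M / M%:R) =
    D' * D * 5 ^+ r * (2 * peak P M / M%:R) by ring.
have K0 : 0 <= D' * D * 5 ^+ r by rewrite !mulr_ge0 ?exprn_ge0.
apply: le_trans (ler_wpM2l K0 (sum_peak_le MP)).
rewrite mulr_sumr big_nat [leRHS]big_nat; apply: ler_sum => p /andP[Mp pP].
have pk0 := peak_ge0 (ltnW pP) P0.
apply: (@le_trans _ _ (\sum_(s <- incseqs r p)
    D' * D * (peak P p / node R p ^+ 2) * \prod_(i <- s) (node R i ^+ 2)^-1)).
  rewrite big_seq [leRHS]big_seq; apply: ler_sum => s sp.
  have sP : rcons s p \in incseqs r.+1 P.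
    apply/allpairsPdep; exists p, s; split => //.
    by rewrite mem_iota.
  have /andP[C0 Cle] : 0 <= C (rcons s p) <=
      D * \prod_(i <- rcons s p) (node R i ^+ 2)^-1.
    by apply: CD; move: sP; rewrite mem_incseqs => /and3P[/eqP].
  apply: le_trans (ler_wpM2r C0 (wD' _ sP)) _.
  rewrite last_rcons; apply: le_trans (ler_wpM2l _ Cle) _.
    exact: mulr_ge0.
  by rewrite big_rcons /= le_eqVlt; apply/orP; left; apply/eqP; ring.
have -> : D' * D * 5 ^+ r * (peak P p / node R p ^+ 2) =
    D' * D * (peak P p / node R p ^+ 2) * 5 ^+ r by ring.
rewrite -mulr_sumr ler_wpM2l ?sum_incseqs_prod_le //.
- by apply: mulr_ge0; [exact: mulr_ge0|rewrite divr_ge0 ?sqr_ge0].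
- by move=> n; rewrite invr_ge0 sqr_ge0.
- exact: sum_node_inv.
Qed.

End Bounds.

(** * Letting the cut-off tend to infinity *)

Section Limits.
Variable R : realType.

Lemma cvg_shift_ratio (a b : R) :
  (fun P : nat => (P%:R + a) / (P%:R + b)) @ \oo --> (1 : R).
Proof.
have inv0 : (fun P : nat => (P%:R + b)^-1) @ \oo --> (0 : R).
  have ev : \forall P \near \oo, 0 < P%:R + b.
    near=> P; rewrite -ltrBlDr sub0r.
    by near: P; exact: nbhs_infty_gtr.
  apply/(gtr0_cvgV0 ev)/cvgryPge => A; near=> P.
  rewrite -lerBlDr; near: P; exact: nbhs_infty_ger.
have -> : (1 : R) = 1 + (a - b) * 0 by rewrite mulr0 addr0.
have : (fun P : nat => 1 + (a - b) * (P%:R + b)^-1) @ \oo --> 1 + (a - b) * 0.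
  by apply: cvgD; [exact: cvg_cst|apply: cvgM; [exact: cvg_cst|]].
apply: cvg_trans; apply: near_eq_cvg; near=> P.
have : 0 < P%:R + b.
  by rewrite -ltrBlDr sub0r; near: P; exact: nbhs_infty_gtr.
by move=> h; field; nonzero.
Unshelve. all: by end_near. Qed.

Lemma cvg_prod_ord n (f : nat -> nat -> R) (l : nat -> R) :
  (forall i, (i < n)%N -> (fun P => f P i) @ \oo --> l i) ->
  (fun P => \prod_(i < n) f P i) @ \oo --> \prod_(i < n) l i.
Proof.
elim: n => [|n IH] fl.
  under eq_fun do rewrite big_ord0.
  by rewrite big_ord0; exact: cvg_cst.
under eq_fun do rewrite big_ord_recr /=.
rewrite big_ord_recr /=; apply: cvgM; last exact: fl.
by apply: IH => i ni; apply: fl; exact: ltnW.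
Qed.

Lemma cvg_damp m : (fun P => damp R P m) @ \oo --> (1 : R).
Proof.
rewrite (_ : (1 : R) = \prod_(i < m) 1); last by rewrite big1.
apply: (@cvg_prod_ord m
  (fun P i => (P%:R + i%:R + 2^-1) / (P%:R + i%:R + 1)) (fun=> 1)) => i _.
under eq_fun do rewrite -!addrA.
exact: cvg_shift_ratio.
Qed.

Lemma cvg_boost n : (fun P => boost R P n) @ \oo --> (1 : R).
Proof.
rewrite (_ : (1 : R) = \prod_(i < n) 1); last by rewrite big1.
apply: (@cvg_prod_ord n
  (fun P i => (P%:R - i%:R - 1) / (P%:R - i%:R - 3 / 2)) (fun=> 1)) => i _.
under eq_fun do rewrite -!addrA.
exact: cvg_shift_ratio.
Qed.

Definition limit_kernel m n : R :=
  half_ratio R m / half_ratio R n * (1 + node R m / node R n).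

Lemma cvg_cut_kernel m n :
  (fun P => cut_kernel R P m n) @ \oo --> limit_kernel m n.
Proof.
have -> : limit_kernel m n =
    half_ratio R m * 1 * (1 / (half_ratio R n * node R n))
    * (m%:R + n%:R + 1).
  have a0 := half_ratio_gt0 R n; have n0 := ler0n R n.
  by rewrite /limit_kernel /node; field; nonzero.
apply: cvgM; last exact: cvg_cst.
apply: cvgM; first by apply: cvgM; [exact: cvg_cst|exact: cvg_damp].
by apply: cvgM; [exact: cvg_boost|exact: cvg_cst].
Qed.

Lemma cvg_cut_kernel_diag i : (fun P => cut_kernel R P i i) @ \oo --> (2 : R).
Proof.
have := @cvg_cut_kernel i i; rewrite /limit_kernel.
rewrite !divff ?gt_eqF ?half_ratio_gt0 ?node_gt0 //.
by rewrite mul1r.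
Qed.

Lemma cvg_peak n : (fun P => peak R P n) @ \oo --> (half_ratio R n)^-1.
Proof.
rewrite -[X in _ --> X]mul1r.
by apply: cvgM; [exact: cvg_boost|exact: cvg_cst].
Qed.

Lemma cvg_big_seq (I : Type) (s : seq I) (f : nat -> I -> R) (l : I -> R) :
  (forall i, (fun P => f P i) @ \oo --> l i) ->
  (fun P => \sum_(i <- s) f P i) @ \oo --> \sum_(i <- s) l i.
Proof.
move=> fl; elim: s => [|i s IH].
  under eq_fun do rewrite big_nil.
  by rewrite big_nil; exact: cvg_cst.
under eq_fun do rewrite big_cons.
by rewrite big_cons; apply: cvgD.
Qed.

(** For P beyond M and M', positivity of w bounds the M-sum by the full sum at P,
    the two full sums agree, and the w'-sum exceeds its M'-part by at most a tail.
    Then P tends to infinity. *)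
Lemma limit_sum_le r (C : seq nat -> R) (w w' : nat -> seq nat -> R)
    (v v' : seq nat -> R) (D D' : R) (M M' : nat) :
  (0 < M')%N -> 0 <= D -> 0 <= D' ->
  (forall t, size t = r.+1 -> 0 <= C t <= D * \prod_(i <- t) (node R i ^+ 2)^-1) ->
  (forall P t, t \in incseqs r.+1 P -> 0 <= w P t) ->
  (forall P t, t \in incseqs r.+1 P -> w' P t <= D' * peak R P (last 0%N t)) ->
  (forall t, (fun P => w P t) @ \oo --> v t) ->
  (forall t, (fun P => w' P t) @ \oo --> v' t) ->
  (forall P, (0 < P)%N -> \sum_(t <- incseqs r.+1 P) w P t * C t =
     \sum_(t <- incseqs r.+1 P) w' P t * C t) ->
  \sum_(t <- incseqs r.+1 M) v t * C t <=
  \sum_(t <- incseqs r.+1 M') v' t * C t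
    + 2 * D' * D * 5 ^+ r * ((half_ratio R M')^-1 / M'%:R).
Proof.
move=> M'0 D0 D'0 CD w0 wD' wv wv' ww'.
have lim1 : (fun P => \sum_(t <- incseqs r.+1 M) w P t * C t) @ \oo -->
    \sum_(t <- incseqs r.+1 M) v t * C t.
  by apply: cvg_big_seq => t; apply: cvgM; [exact: wv|exact: cvg_cst].
have lim2 : (fun P => \sum_(t <- incseqs r.+1 M') w' P t * C t
     + 2 * D' * D * 5 ^+ r * (peak R P M' / M'%:R)) @ \oo -->
    \sum_(t <- incseqs r.+1 M') v' t * C t
    + 2 * D' * D * 5 ^+ r * ((half_ratio R M')^-1 / M'%:R).
  apply: cvgD.
    by apply: cvg_big_seq => t; apply: cvgM; [exact: wv'|exact: cvg_cst].
  apply: cvgM; first exact: cvg_cst.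
  by apply: cvgM; [exact: cvg_peak|exact: cvg_cst].
apply: ler_cvg_to lim1 lim2 _; near=> P.
have MP : (M <= P)%N by near: P; exists M.
have M'P : (M' <= P)%N by near: P; exists M'.
apply: (@le_trans _ _ (\sum_(t <- incseqs r.+1 P) w P t * C t)).
  rewrite !big_incseqsS -!(big_mkord xpredT (fun p =>
    \sum_(s <- incseqs r p) w P (rcons s p) * C (rcons s p))).
  rewrite [leRHS](big_cat_nat (n := M)) //= lerDl big_nat.
  rewrite sumr_ge0 // => p /andP[_ pP].
  rewrite big_seq sumr_ge0 // => s sp.
  have sP : rcons s p \in incseqs r.+1 P.
    by apply/allpairsPdep; exists p, s; split => //; rewrite mem_iota.
  rewrite mulr_ge0 ?w0 //.
  by move: sP; rewrite mem_incseqs => /and3P[/eqP/CD/andP[]].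
rewrite ww' ?(leq_trans M'0) //.
apply: sum_incseqs_tail => //; last exact: wD'.
by apply/andP.
Unshelve. all: by end_near. Qed.

Lemma half_ratio_inv_small (e : R) : 0 < e ->
  exists2 M, (0 < M)%N & (half_ratio R M)^-1 / M%:R <= e.
Proof.
move=> e0; have e2 : 0 < 4 / e ^+ 2 by rewrite divr_gt0 // exprn_gt0.
exists (Num.bound (4 / e ^+ 2)).+1 => //; set M := _.+1.
have M1 : 1 <= M%:R :> R by rewrite ler1n.
have eM : 4 / e ^+ 2 <= M%:R.
  by apply: ltW; apply: lt_le_trans (archi_boundP (ltW e2)) _; rewrite ler_nat.
have a0 := half_ratio_gt0 R M.
have q0 : 0 <= (half_ratio R M)^-1 / M%:R by rewrite divr_ge0 ?invr_ge0 // ltW.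
rewrite -ler_sqr ?nnegrE ?(ltW e0) // expr_div_n exprVn.
have M0 : 0 < M%:R :> R by rewrite (lt_le_trans ltr01).
have h : (half_ratio R M ^+ 2)^-1 <= 4 * M%:R.
  rewrite -[leRHS]invrK lef_pV2 ?posrE ?exprn_gt0 ?invr_gt0 ?mulr_gt0 //.
  exact: half_ratio_sqr_ge.
rewrite ler_pdivrMr ?exprn_gt0 //; apply: le_trans h _.
rewrite expr2 mulrA ler_pM2r //; move: eM.
by rewrite ler_pdivrMr ?exprn_gt0 // mulrC.
Qed.

End Limits.

(** * Comparison of the infinite sums *)

Section Sums.
Variable R : realType.

(** A finite set of increasing tuples is contained in a finite box, so the partial
    sums over boxes are cofinal. *)
Lemma esum_incseqs r (f : seq nat -> R) :
  (forall P t, t \in incseqs r P -> 0 <= f t) ->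
  \esum_(n in [set n : r.-tuple nat | sorted ltn n]) (f n)%:E =
  ereal_sup (range (fun P => (\sum_(t <- incseqs r P) f t)%:E)).
Proof.
move=> f0; pose Q := [set t : seq nat | size t = r /\ sorted ltn t].
have bij : set_bij [set n : r.-tuple nat | sorted ltn n] Q val.
  split=> [n /= sn|n n' _ _|t [st so]]; first by split; rewrite ?size_tuple.
    exact: val_inj.
  by exists (tcast st (in_tuple t)) => /=; rewrite ?val_tcast.
rewrite -(reindex_esum _ Q val (fun t => (f t)%:E) bij).
have sumE P : (\sum_(t <- incseqs r P) f t)%:E =
    (\sum_(t \in [set` incseqs r P]) (f t)%:E)%E.
  by rewrite -fsbig_seq ?incseqs_uniq // sumEFin.
apply/eqP; rewrite eq_le; apply/andP; split; last first.
  apply: ge_ereal_sup => _ [P _ <-]; rewrite sumE; apply: esum_ge.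
  exists [set` incseqs r P] => //; split; first exact: finite_seq.
  by move=> t /=; rewrite mem_incseqs => /and3P[/eqP].
apply: ge_ereal_sup => _ [X [finX XQ] <-].
have [s Xs] : exists s : seq (seq nat), X = [set` s] by exact/finite_seqP.
pose P := (\max_(t <- s) \max_(i <- t) i).+1.
apply: (@le_trans _ _ (\sum_(t <- incseqs r P) f t)%:E); last first.
  by apply: ereal_sup_ubound; exists P.
rewrite sumE; apply: lee_fsum_nneg_subset => //.
- exact: finite_seq.
- move=> t; rewrite !inE => /[dup] Xt /XQ[st so] /=.
  rewrite mem_incseqs st eqxx so /=; apply/allP => i it; rewrite /P ltnS.
  apply: (@leq_trans (\max_(i <- t) i)%N).
    exact: (@leq_bigmax_seq _ t xpredT (fun j => j) i it isT).
  have ts : t \in s by move: Xt; rewrite Xs.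
  exact: (@leq_bigmax_seq _ s xpredT (fun t => \max_(i <- t) i)%N).
- move=> t; rewrite inE => /andP[_]; rewrite inE => tP.
  by rewrite lee_fin (f0 P).
Qed.

Lemma node_monomial_ge0 r k (c : r.-tuple 'I_k.+1) t : 0 <= node_monomial R c t.
Proof.
rewrite invr_ge0 prodr_ge0 // => i _.
by rewrite exprn_ge0 // ltW ?node_gt0.
Qed.

(** Each exponent 2 c_i is at least 2, and the excess costs at most
    (1 / x^2)^(c_i - 1) <= 4^k, since x >= 1/2. *)
Lemma composition_sum_bound r k (t : seq nat) : size t = r ->
  0 <= composition_sum R r k t <=
  (\sum_(c : r.-tuple 'I_k.+1 | is_composition c) (4 ^+ k) ^+ r)
    * \prod_(i <- t) (node R i ^+ 2)^-1.
Proof.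
move=> st; apply/andP; split.
  by apply: sumr_ge0 => c _; exact: node_monomial_ge0.
rewrite mulr_suml; apply: ler_sum => c /andP[/forallP c0 _].
have -> : (4 ^+ k) ^+ r * \prod_(i <- t) (node R i ^+ 2)^-1 =
    \prod_(i < r) (4 ^+ k * (node R (nth 0%N t i) ^+ 2)^-1).
  by rewrite big_split prodr_const card_ord (big_nth 0%N) st big_mkord.
rewrite /node_monomial -prodfV; apply: ler_prod => i _ /=.
set x := node R _; have x0 : 0 < x := node_gt0 R _; have x0' := ltW x0.
rewrite invr_ge0 exprn_ge0 //=.
have := c0 i; case: (tnth c i) => -[|j] //= jk _.
rewrite mulnS exprD invfM mulrC ler_wpM2r ?invr_ge0 ?exprn_ge0 //.
have x4 : (x ^+ 2)^-1 <= 4.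
  rewrite -[leRHS]invrK lef_pV2 ?posrE ?exprn_gt0 ?invr_gt0 //.
  by rewrite /x /node; have := ler0n R (nth 0%N t i); set y := _%:R => y0; nra.
rewrite exprM -exprVn; apply: (@le_trans _ _ (4 ^+ j)).
  by rewrite lerXn2r // nnegrE ?invr_ge0 ?exprn_ge0.
by apply: ler_weXn2l; [lra|rewrite -ltnS ltnW].
Qed.

(** M' is chosen so large that the error term of [limit_sum_le] is negligible. *)
Lemma esum_limit_le r (C : seq nat -> R) (w w' : nat -> seq nat -> R)
    (v v' : seq nat -> R) (D D' : R) :
  0 <= D -> 0 <= D' ->
  (forall t, size t = r.+1 -> 0 <= C t <= D * \prod_(i <- t) (node R i ^+ 2)^-1) ->
  (forall P t, t \in incseqs r.+1 P -> 0 <= w P t) ->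
  (forall P t, t \in incseqs r.+1 P -> w' P t <= D' * peak R P (last 0%N t)) ->
  (forall t, (fun P => w P t) @ \oo --> v t) ->
  (forall t, (fun P => w' P t) @ \oo --> v' t) ->
  (forall P, (0 < P)%N -> \sum_(t <- incseqs r.+1 P) w P t * C t =
     \sum_(t <- incseqs r.+1 P) w' P t * C t) ->
  (ereal_sup (range (fun P => (\sum_(t <- incseqs r.+1 P) v t * C t)%:E)) <=
   ereal_sup (range (fun P => (\sum_(t <- incseqs r.+1 P) v' t * C t)%:E)))%E.
Proof.
move=> D0 D'0 CD w0 wD' wv wv' ww'.
apply: ge_ereal_sup => _ [M _ <-]; apply/lee_addgt0Pr => e e0.
pose K := 2 * D' * D * 5 ^+ r.
have K0 : 0 <= K by rewrite !mulr_ge0 ?exprn_ge0.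
have [|M' M'0 small] := @half_ratio_inv_small R (e / (K + 1)).
  by rewrite divr_gt0 // ltr_wpDl.
have := limit_sum_le M M'0 D0 D'0 CD w0 wD' wv wv' ww'; rewrite -/K => le.
apply: (@le_trans _ _ ((\sum_(t <- incseqs r.+1 M') v' t * C t)%:E + e%:E)%E).
  rewrite -EFinD lee_fin; apply: le_trans le _; rewrite lerD2l.
  apply: le_trans (ler_wpM2l K0 small) _.
  rewrite mulrCA ler_piMr ?(ltW e0) // ler_pdivrMr ?ltr_wpDl // mul1r.
  by rewrite lerDl.
by rewrite leeD2r // ereal_sup_ubound //; exists M'.
Qed.

Lemma limit_kernel_ge0 m n : 0 <= limit_kernel R m n.
Proof.
by rewrite mulr_ge0 ?addr_ge0 ?divr_ge0 // ltW ?half_ratio_gt0 ?node_gt0.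
Qed.

(** The hypotheses of [esum_limit_le] are symmetric in the two families of weights:
    the kernel at the ends, and its diagonal summed over the entries. *)
Lemma esum_weights_eq r k : (r < k)%N ->
  \esum_(n in [set n : r.+1.-tuple nat | sorted ltn n])
    (limit_kernel R (head 0%N n) (last 0%N n) * composition_sum R r.+1 k n)%:E =
  \esum_(n in [set n : r.+1.-tuple nat | sorted ltn n])
    (2 * r.+1%:R * composition_sum R r.+1 k n)%:E.
Proof.
move=> rk.
pose C := composition_sum R r.+1 k.
pose D : R :=
  \sum_(c : r.+1.-tuple 'I_k.+1 | is_composition c) (4 ^+ k) ^+ r.+1.
have D0 : 0 <= D by apply: sumr_ge0 => c _; rewrite !exprn_ge0.
have CD t : size t = r.+1 -> 0 <= C t <= D * \prod_(i <- t) (node R i ^+ 2)^-1.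
  exact: composition_sum_bound.
pose w P t := cut_kernel R P (head 0%N t) (last 0%N t).
pose w' P t := \sum_(i <- t) cut_kernel R P i i.
pose v t := limit_kernel R (head 0%N t) (last 0%N t).
pose v' (t : seq nat) : R := \sum_(i <- t) 2.
have memP P t : t \in incseqs r.+1 P ->
    (forall i, i \in t -> (i <= last 0 t < P)%N) /\
    head 0%N t \in t /\ size t = r.+1.
  rewrite mem_incseqs; case/lastP: t => // t p /and3P[/eqP st so al].
  split; last first.
    by split => //; case: (t) {so al} st => [|? ?] _; rewrite /= inE eqxx.
  have pP : (p < P)%N by apply: (allP al); rewrite mem_rcons mem_head.
  move=> i it; rewrite last_rcons pP andbT.
  have ltnT : transitive ltn by move=> ? ? ?; apply: ltn_trans.
  move: so; rewrite (sorted_pairwise ltnT) pairwise_rcons => /andP[/allP tp _].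
  by move: it; rewrite mem_rcons inE => /predU1P[->//|/tp/ltnW].
have w0 P t : t \in incseqs r.+1 P -> 0 <= w P t.
  move=> /memP[tP [ht _]]; rewrite /w cut_kernel_ge0 //.
  by have /andP[_] := tP _ ht.
have w'0 P t : t \in incseqs r.+1 P -> 0 <= w' P t.
  move=> /memP[tP [ht _]]; rewrite /w' big_seq sumr_ge0 // => i it.
  by rewrite cut_kernel_ge0 //; have /andP[] := tP _ it; apply: leq_ltn_trans.
have wD P t : t \in incseqs r.+1 P -> w P t <= 2 * peak R P (last 0%N t).
  by move=> /memP[tP [ht _]]; apply: cut_kernel_le_peak; exact: tP.
have w'D P t : t \in incseqs r.+1 P ->
    w' P t <= (2 * r.+1%:R) * peak R P (last 0%N t).
  move=> /memP[tP [ht st]].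
  have -> : 2 * r.+1%:R * peak R P (last 0%N t) =
      \sum_(i <- t) 2 * peak R P (last 0%N t).
    by rewrite big_const_seq count_predT st iter_addr_0 -mulr_natr; ring.
  rewrite /w' big_seq [leRHS]big_seq; apply: ler_sum => i it.
  by apply: cut_kernel_diag_le_peak; exact: tP.
have wv t : (fun P => w P t) @ \oo --> v t by exact: cvg_cut_kernel.
have wv' t : (fun P => w' P t) @ \oo --> v' t.
  by apply: cvg_big_seq => i; exact: cvg_cut_kernel_diag.
have ww' P : (0 < P)%N -> \sum_(t <- incseqs r.+1 P) w P t * C t =
    \sum_(t <- incseqs r.+1 P) w' P t * C t by exact: cut_identity_coef.
have v0 t : 0 <= v t by exact: limit_kernel_ge0.
transitivity (ereal_sup (range (fun P =>
  (\sum_(t <- incseqs r.+1 P) v t * C t)%:E))).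
  rewrite -(esum_incseqs (f := fun t => v t * C t)) // => P t /memP[_ [_ st]].
  by rewrite mulr_ge0 //; case/andP: (CD _ st).
transitivity (ereal_sup (range (fun P =>
  (\sum_(t <- incseqs r.+1 P) v' t * C t)%:E))).
  apply/eqP; rewrite eq_le; apply/andP; split.
    exact: (esum_limit_le D0 _ CD w0 w'D wv wv' ww').
  by apply: (esum_limit_le D0 _ CD w'0 wD wv' wv) => // P P0; rewrite ww'.
have v'E t : size t = r.+1 -> v' t = 2 * r.+1%:R.
  by move=> st; rewrite /v' big_const_seq count_predT st iter_addr_0 mulr_natr.
rewrite -(esum_incseqs (f := fun t => v' t * C t)).
  by apply: eq_esum => n _; rewrite v'E ?size_tuple.
move=> P t /memP[_ [_ st]]; rewrite v'E // !mulr_ge0 //.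
by case/andP: (CD _ st).
Qed.

Lemma pochhammer_half n : pochhammer (2^-1 : R) n / (n`!)%:R = half_ratio R n.
Proof.
rewrite /pochhammer /half_ratio big_split prodfV; congr (_ / _) => /=.
  by apply: eq_bigr => i _; rewrite addrC.
rewrite fact_prod big_add1 big_mkord natr_prod.
by apply: eq_bigr => i _; rewrite natr1.
Qed.

Lemma esumZl (T : choiceType) (S : set T) (a : R) (f : T -> R) : 0 < a ->
  \esum_(x in S) (a * f x)%:E = (a%:E * \esum_(x in S) (f x)%:E)%E.
Proof.
move=> a0; rewrite /esum -ereal_sup_pZl // image_comp; congr ereal_sup.
apply: eq_imagel => X [finX _] /=.
by rewrite !fsbig_finite // !sumEFin -EFinM mulr_sumr.
Qed.

(** Lowering the first exponent and raising the last one by one multiplies the term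
    by x_{n_1} / x_{n_r}. *)
Lemma Z_sum_pair r k (c : r.+1.-tuple 'I_k.+1) : is_composition c ->
  (Z_sum R (doubled c) + Z_sum R (doubled_shifted c))%E =
  \esum_(n in [set n : r.+1.-tuple nat | sorted ltn n])
    (limit_kernel R (head 0%N n) (last 0%N n) * node_monomial R c n)%:E.
Proof.
move=> /andP[/forallP c0 _].
have head0 (n : r.+1.-tuple nat) : head 0%N n = nth 0%N n 0 by rewrite nth0.
have last0 (n : r.+1.-tuple nat) : last 0%N n = nth 0%N n r.
  by rewrite -nth_last size_tuple.
have weight (n : r.+1.-tuple nat) :
    pochhammer 2^-1 (head 0%N n) / ((head 0%N n)`!)%:R
   = half_ratio R (head 0%N n) by rewrite pochhammer_half.
have weight' (n : r.+1.-tuple nat) :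
    ((last 0%N n)`!)%:R / pochhammer 2^-1 (last 0%N n)
   = (half_ratio R (last 0%N n))^-1 by rewrite -pochhammer_half invf_div.
have pos (e n : r.+1.-tuple nat) :
    (0 <= (pochhammer 2^-1 (head 0%N n) / ((head 0%N n)`!)%:R
     * (\prod_(i < r.+1) ((tnth n i)%:R + 2^-1) ^+ tnth e i)^-1
     * (((last 0%N n)`!)%:R / pochhammer 2^-1 (last 0%N n)))%:E :> \bar R)%E.
  have hr0 m := ltW (half_ratio_gt0 R m).
  rewrite lee_fin weight weight'; apply: mulr_ge0; last by rewrite invr_ge0.
  apply: mulr_ge0 => //; rewrite invr_ge0; apply: prodr_ge0 => i _.
  by rewrite exprn_ge0 // addr_ge0.
rewrite /Z_sum -esumD; last 2 first.
- by move=> n _; exact: pos.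
- by move=> n _; exact: pos.
apply: eq_esum => n _; rewrite -EFinD weight weight'; congr (_%:E).
have nodeE e : \prod_(i < r.+1) ((tnth n i)%:R + 2^-1) ^+ tnth e i =
    \prod_(i < r.+1) node R (nth 0%N n i) ^+ tnth e i.
  by apply: eq_bigr => i _; rewrite (tnth_nth 0%N n).
rewrite !nodeE.
have -> : \prod_(i < r.+1) node R (nth 0%N n i) ^+ tnth (doubled c) i =
    (node_monomial R c n)^-1.
  by rewrite invrK; apply: eq_bigr => i _; rewrite tnth_mktuple.
have -> : \prod_(i < r.+1) node R (nth 0%N n i) ^+ tnth (doubled_shifted c) i =
    (node_monomial R c n)^-1 * node R (last 0%N n) / node R (head 0%N n).
  rewrite invrK head0 last0.
  have delta (j : 'I_r.+1) : node R (nth 0%N n j) =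
      \prod_(i < r.+1) node R (nth 0%N n i) ^+ (i == j :> nat).
    rewrite (bigD1 j) //= eqxx expr1 big1 ?mulr1 // => i ij.
    by rewrite (val_eqE i j) (negbTE ij) expr0.
  have := delta ord_max; have := delta ord0 => /= e0 er.
  apply: (canRL (mulfK _)); first by rewrite gt_eqF ?node_gt0.
  rewrite e0 er -!big_split; apply: eq_bigr => i _ /=.
  rewrite -!exprD tnth_mktuple; congr (_ ^+ _) => /=.
  by have := c0 i; lia.
have a0 := half_ratio_gt0 R (last 0%N n).
have h0 := node_gt0 R (head 0%N n); have l0 := node_gt0 R (last 0%N n).
rewrite !invfM !invrK /limit_kernel.
by field; nonzero.
Qed.

(** Shifting every index by one turns 2 n - 1 into 2 x_n. *)
Lemma t_sum_doubled r k (c : r.-tuple 'I_k.+1) : is_composition c ->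
  t_sum R (doubled c) = \esum_(n in [set n : r.-tuple nat | sorted ltn n])
    ((4 ^+ k)^-1 * node_monomial R c n)%:E.
Proof.
move=> /andP[_ /eqP ck].
pose shift (n : r.-tuple nat) : r.-tuple nat := map_tuple S n.
have bij : set_bij [set n : r.-tuple nat | sorted ltn n]
    [set n : r.-tuple nat | all (ltn 0) n && sorted ltn n] shift.
  split.
  - move=> n /= sn; rewrite all_map (introT allP) //=.
    by rewrite sorted_map.
  - move=> n n' _ _ /(congr1 val) /= /(inj_map succn_inj); exact: val_inj.
  - move=> n /= /andP[n0 sn].
    have nE : map S (map predn n) = n.
      rewrite -map_comp -[RHS]map_id; apply/eq_in_map => i /(allP n0) /=.
      exact: prednK.
    exists (map_tuple predn n); last exact: val_inj.
    by move: sn; rewrite -{1}nE sorted_map.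
rewrite /t_sum (reindex_esum _ _ shift _ bij); apply: eq_esum => n _.
congr (_%:E); rewrite /node_monomial -invfM; congr (_^-1).
have -> : 4 ^+ k = \prod_(i < r) 4 ^+ tnth c i :> R by rewrite -expr_sum ck.
rewrite -big_split; apply: eq_bigr => i _ /=.
rewrite !tnth_mktuple tnth_map (tnth_nth 0%N) -natr1 /node.
have -> : 4 = 2 ^+ 2 :> R by rewrite expr2; ring.
rewrite -exprM -exprMn; congr (_ ^+ _); by field.
Qed.

End Sums.

Theorem theorem1p4 (R : realType) (k r : nat) (hr : (2 <= r)%N) (hk : (r <= k)%N) :
  (\sum_(c : r.-tuple 'I_k.+1 | is_composition c)
      (Z_sum R (doubled c) + Z_sum R (doubled_shifted c))
   = (2 ^+ (2 * k + 1) * r%:R)%:E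
     * \sum_(c : r.-tuple 'I_k.+1 | is_composition c) t_sum R (doubled c))%E.
Proof.
case: r hr hk => // r _ rk.
rewrite (eq_bigr _ (@Z_sum_pair R r k)) -esum_sum; last first.
  move=> n c _ _; rewrite lee_fin mulr_ge0 ?limit_kernel_ge0 //.
  exact: node_monomial_ge0.
under eq_esum do rewrite sumEFin -mulr_sumr.
rewrite (esum_weights_eq R rk) (eq_bigr _ (@t_sum_doubled R r.+1 k)).
rewrite -esum_sum; last first.
  move=> n c _ _; rewrite lee_fin; apply: mulr_ge0.
    by rewrite invr_ge0 exprn_ge0.
  exact: node_monomial_ge0.
under [in RHS]eq_esum do rewrite sumEFin.
rewrite -esumZl; last by rewrite mulr_gt0 ?exprn_gt0 ?ltr0n.
apply: eq_esum => n _; congr (_%:E).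
rewrite -mulr_sumr mulrA; congr (_ * _).
have -> : 2 ^+ (2 * k + 1) = 4 ^+ k * 2 :> R.
  by rewrite exprD exprM expr1; congr (_ ^+ _ * _); ring.
have k0 : 4 ^+ k != 0 :> R by rewrite expf_neq0.
by field.
Qed.
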